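(* Fix $d\ge2$. For finite sets $S\subseteq\mathbb{Z}^d$, $p_{\mathbb{Z}^d}(S)\ge \frac{(1+o(1))|S|}{\ln|S|}$, where $o(1)\to0$ as $|S|\to\infty$.
   Context: $p_{\mathbb{Z}^d}(S)$ is the largest number of colors for which there is a coloring of $\mathbb{Z}^d$ such that every translate $\mathbf{n}+S=\{\mathbf{n}+\mathbf{s}:\mathbf{s}\in S\}$, $\mathbf{n}\in\mathbb{Z}^d$, contains an element of each color. (Known result usable: for finite $S\subseteq\mathbb{Z}$, $p_{\mathbb{Z}}(S)\ge\frac{(1+o(1))|S|}{\ln|S|}$, due to Alon–Kříž–Nešetřil and Harris–Srinivasan.) *)

(* Defs.v *)
From Stdlib Require Import Reals ZArith List.
Import ListNotations.

Definition pt (d : nat) (x : list Z) : Prop := length x = d.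

Definition vadd (n s : list Z) : list Z :=
  map (fun p => (fst p + snd p)%Z) (combine n s).

(* A finite set S ⊆ Z^d, given as a duplicate-free list of points;
   its cardinality |S| is [length S]. *)
Definition finset_Zd (d : nat) (S : list (list Z)) : Prop :=
  NoDup S /\ Forall (pt d) S.

Definition polychromatic_coloring (d : nat) (S : list (list Z)) (k : nat)
    (c : list Z -> nat) : Prop :=
  (forall x, pt d x -> (c x < k)%nat) /\
  (forall n, pt d n -> forall j, (j < k)%nat ->
      exists s, In s S /\ c (vadd n s) = j).

(* "p_{Z^d}(S) >= x": since p_{Z^d}(S) is the LARGEST number of colors for which
   a polychromatic coloring exists, p_{Z^d}(S) >= x holds iff some number
   k >= x of colors admits a polychromatic coloring. *)
Definition p_Zd_ge (d : nat) (S : list (list Z)) (x : R) : Prop :=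
  exists k : nat, (INR k >= x)%R /\
    exists c : list Z -> nat, polychromatic_coloring d S k c.

(* Main.v *)
Require Import Defs.
From Stdlib Require Import Reals ZArith List Lra Lia.
From mathcomp Require all_boot all_order all_algebra ring lra zify Rstruct.

(** Reducing modulo a large integer after an injective linear map to [Z] turns
    the translates of [S] into the edges of a finite hypergraph in which every
    edge has [m = |S|] vertices and every vertex lies in at most [m] edges.
    Colouring the vertices uniformly with [k] colours and applying the local
    lemma directly only yields [k ~ m / (3 ln m)]: a translate misses a colour
    with probability about [k exp (- m / k)], and it meets up to [m ^ 2] others.
    Instead, with [x = ln m], first split the vertices into about [m / x ^ 2]
    classes so that every edge has at least about [x ^ 2] vertices in every
    class (Chernoff bound and local lemma).  Inside one class, shrunken edges
    of size about [x ^ 2] meet only about [m x ^ 2] others, so the local lemma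
    now permits about [x] colours per class, and [m / x] colours in total. *)

(** * Choice of the parameters *)

Local Open Scope R_scope.

(* [t] classes, each with more than [a] vertices of every edge, then [k] colours
   per class; [q] and [r] bound the probabilities that a given edge of size [m]
   (resp. [S a]) has at most [a] (resp. no) vertices of a given class (resp. colour),
   and [z] is the weight of the Chernoff bound. *)
Definition two_step_parameters (m t a k : nat) (z q r : R) : Prop :=
  ((0 < m)%nat /\ (0 < t)%nat /\ (0 < k)%nat) /\
  (0 < z <= 1 /\ 0 <= q /\ 0 <= r) /\
  ((INR t - 1 + z) ^ m <= q * z ^ a * INR t ^ m /\
   4 * (INR t * q) * (INR m * INR m) <= 1) /\
  ((INR k - 1) ^ S a <= r * INR k ^ S a /\
   4 * (INR k * r) * (INR (S a) * INR m) <= 1).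

Lemma exp_pow (u : R) (n : nat) : exp u ^ n = exp (INR n * u).
Proof.
  induction n as [|n IH].
  - simpl. rewrite Rmult_0_l, exp_0. reflexivity.
  - rewrite S_INR. simpl. rewrite IH, <- exp_plus. f_equal. ring.
Qed.

(** This is [1 + u <= exp u] at [u = y / n], raised to the power [n]. It serves to compare powers of
    [x = ln m] with [m] and with [exp (delta * x)]. *)
Lemma pow_le_exp (n : nat) (y : R) : 0 <= y -> (y / INR n) ^ n <= exp y.
Proof.
  intros Hy. destruct n as [|n].
  { simpl. rewrite <- exp_0. destruct Hy as [Hy|<-]; [|lra].
    left. apply exp_increasing, Hy. }
  assert (Hn : 0 < INR (S n)) by (apply lt_0_INR; lia).
  replace y with (INR (S n) * (y / INR (S n))) at 2 by (field; lra).
  rewrite <- exp_pow. apply pow_incr. split.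
  - apply Rmult_le_pos; [exact Hy|]. left. apply Rinv_0_lt_compat, Hn.
  - pose proof (exp_ineq1_le (y / INR (S n))). lra.
Qed.

(** Follows from [1 - v <= exp (- v)] at [v = u / t]; [u <= t] keeps the base nonnegative. It gives
    both tail bounds, with [u = delta] for classes and [u = 1] for colours. *)
Lemma sub_pow_le_exp (t u : R) (n : nat) :
  0 < t -> u <= t -> (t - u) ^ n <= exp (- (u * INR n / t)) * t ^ n.
Proof.
  intros Ht Hu.
  replace (- (u * INR n / t)) with (INR n * (- (u / t))) by (field; lra).
  rewrite <- exp_pow, <- Rpow_mult_distr. apply pow_incr. split; [lra|].
  pose proof (exp_ineq1_le (- (u / t))) as H.
  apply Rmult_le_compat_r with (r := t) in H; [|lra].
  replace ((1 + - (u / t)) * t) with (t - u) in H by (field; lra). exact H.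
Qed.

Lemma one_sub_pow_ge (n : nat) (u : R) : 0 <= u <= 1 -> 1 - INR n * u <= (1 - u) ^ n.
Proof.
  intros Hu. induction n as [|n IH]; [simpl; lra|].
  rewrite S_INR. simpl.
  apply Rmult_le_compat_l with (r := 1 - u) in IH; [|lra].
  pose proof (Rmult_le_pos _ _ (pos_INR n) (Rle_0_sqr u)). unfold Rsqr in *. lra.
Qed.

Lemma nat_floor (y : R) : 0 <= y -> exists n : nat, INR n <= y < INR n + 1.
Proof.
  intros Hy. destruct (archimed y) as [H1 H2].
  assert (Hup : (0 < up y)%Z) by (apply lt_IZR; lra).
  exists (Z.to_nat (up y - 1)).
  rewrite INR_IZR_INZ, Z2Nat.id by lia. rewrite minus_IZR. lra.
Qed.

(** With [x = ln m], take [t] about [m / x ^ 2], [a] about [((1 - delta) * x) ^ 2], [k] about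
    [a / ((1 + delta) * x)] and [z = 1 - delta]. The losses are a factor [1 - delta] in [t] and
    [(1 - delta) ^ 4] in [k]; Bernoulli's inequality bounds their product below by
    [1 - 5 * delta]. *)
Lemma exists_two_step_parameters (delta : R) (m : nat) :
  0 < delta <= 1 / 5 -> 50000 / delta ^ 5 <= ln (INR m) ->
  exists t a k z q r, two_step_parameters m t a k z q r /\
    (1 - 5 * delta) * INR m / ln (INR m) <= INR (t * k).
Proof.
  intros Hd Hx. set (x := ln (INR m)) in *.
  assert (Hd5 : 0 < delta ^ 5) by (apply pow_lt; lra).
  assert (Hx1 : 50000 <= x * delta ^ 5).
  { apply Rmult_le_compat_r with (r := delta ^ 5) in Hx; [|lra].
    unfold Rdiv in Hx. rewrite Rmult_assoc, Rinv_l, Rmult_1_r in Hx; lra. }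
  assert (Hd5' : forall n, delta ^ S n <= delta ^ n).
  { intros n. simpl. pose proof (pow_lt delta n). nra. }
  assert (Hx0 : 0 < x) by nra.
  assert (Hxd4 : 50000 <= x * delta ^ 4) by (pose proof (Hd5' 4%nat); nra).
  assert (Hxd3 : 50000 <= x * delta ^ 3) by (pose proof (Hd5' 3%nat); nra).
  assert (Hxd2 : 50000 <= x * delta ^ 2) by (pose proof (Hd5' 2%nat); nra).
  assert (Hxd1 : 50000 <= x * delta).
  { pose proof (Hd5' 1%nat) as H. rewrite pow_1 in H. nra. }
  assert (Hxbig : 50000 <= x) by nra.
  (* [ln] takes the default value 0 on nonpositive reals, so [x > 0] already excludes [m = 0]. *)
  assert (Hm0 : 0 < INR m).
  { destruct (Rle_lt_dec (INR m) 0) as [H|H]; [|exact H].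
    unfold x, ln in Hx0. destruct (Rlt_dec 0 (INR m)); lra. }
  assert (Hm : INR m = exp x) by (unfold x; rewrite exp_ln; auto).
  assert (Hmx : x ^ 2 <= delta * INR m).
  { pose proof (pow_le_exp 3 x (Rlt_le _ _ Hx0)) as H. rewrite <- Hm in H.
    apply Rle_trans with (delta * (x / INR 3) ^ 3).
    - replace (delta * (x / INR 3) ^ 3) with (x ^ 2 * (x * delta / 27))
        by (simpl; field).
      pose proof (pow_lt x 2 Hx0). nra.
    - apply Rmult_le_compat_l; lra. }
  (* The constant in the hypothesis comes from here: [50000 = 16 * 5 ^ 5], and the fifth power
     leaves one spare factor [x] over [x ^ 4]. *)
  assert (Hmd : 16 * x ^ 4 <= exp (delta * x)).
  { apply Rle_trans with ((delta * x / INR 5) ^ 5); [|apply pow_le_exp; nra].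
    replace ((delta * x / INR 5) ^ 5) with (x ^ 4 * (x * delta ^ 5 / 3125))
      by (simpl; field).
    pose proof (pow_lt x 4 Hx0). nra. }
  assert (Hm4 : 4 <= INR m).
  { rewrite Hm. pose proof (exp_ineq1_le x). lra. }
  assert (Hx2 : 0 < x ^ 2) by (apply pow_lt; lra).
  destruct (nat_floor (INR m / x ^ 2)) as [t [Ht1 Ht2]].
  { apply Rmult_le_pos; [lra|]. left. apply Rinv_0_lt_compat; lra. }
  destruct (nat_floor ((1 - delta) ^ 2 * x ^ 2)) as [a [Ha1 Ha2]].
  { apply Rmult_le_pos; [apply pow2_ge_0|lra]. }
  (* Since [m / x ^ 2] is at least [1 / delta], rounding it down to [t] costs at most a factor
     [1 - delta]. *)
  assert (Hmx' : 1 / delta <= INR m / x ^ 2).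
  { apply Rmult_le_reg_r with (delta * x ^ 2); [nra|].
    replace (1 / delta * (delta * x ^ 2)) with (x ^ 2) by (field; lra).
    replace (INR m / x ^ 2 * (delta * x ^ 2)) with (delta * INR m) by (field; lra).
    exact Hmx. }
  assert (Ht3 : (1 - delta) * (INR m / x ^ 2) <= INR t).
  { apply Rmult_le_compat_l with (r := delta) in Hmx'; [|lra].
    replace (delta * (1 / delta)) with 1 in Hmx' by (field; lra). lra. }
  assert (Ht0 : 0 < INR t).
  { assert (5 <= 1 / delta).
    { apply Rmult_le_reg_r with delta; [lra|].
      replace (1 / delta * delta) with 1 by (field; lra). lra. }
    nra. }
  assert (HtL : INR t * x ^ 2 <= INR m).
  { apply Rmult_le_compat_r with (r := x ^ 2) in Ht1; [|lra].
    replace (INR m / x ^ 2 * x ^ 2) with (INR m) in Ht1 by (field; lra). exact Ht1. }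
  assert (HtL' : x ^ 2 <= INR m / INR t).
  { apply Rmult_le_reg_r with (INR t); [lra|].
    replace (INR m / INR t * INR t) with (INR m) by (field; lra). lra. }
  set (L := INR (S a)).
  assert (HL1 : (1 - delta) ^ 2 * x ^ 2 <= L) by (unfold L; rewrite S_INR; lra).
  assert (HL2 : L <= 2 * x ^ 2) by (unfold L; rewrite S_INR; nra).
  assert (HL0 : 0 < L) by (apply lt_0_INR; lia).
  destruct (nat_floor (L / ((1 + delta) * x))) as [k [Hk1 Hk2]].
  { apply Rmult_le_pos; [lra|]. left. apply Rinv_0_lt_compat; nra. }
  (* One factor [1 - delta] absorbs the division by [1 + delta], another the rounding down; the
     other two come from [a]. *)
  assert (Hk3 : (1 - delta) ^ 4 * x <= INR k).
  { assert (H : (1 - delta) ^ 3 * x <= L / ((1 + delta) * x)).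
    { apply Rmult_le_reg_r with ((1 + delta) * x); [nra|].
      replace (L / ((1 + delta) * x) * ((1 + delta) * x)) with L by (field; lra).
      apply Rle_trans with (2 := HL1).
      replace ((1 - delta) ^ 3 * x * ((1 + delta) * x))
        with ((1 - delta) ^ 2 * x ^ 2 * (1 - delta ^ 2)) by ring.
      pose proof (pow2_ge_0 delta). pose proof (pow2_ge_0 (1 - delta)). nra. }
    assert (H2 : 1 <= (1 - delta) ^ 3 * (x * delta)).
    { assert ((4 / 5) ^ 3 <= (1 - delta) ^ 3) by (apply pow_incr; lra). nra. }
    replace ((1 - delta) ^ 4 * x)
      with ((1 - delta) ^ 3 * x - (1 - delta) ^ 3 * (x * delta)) by ring.
    lra. }
  assert (Hk0 : 0 < INR k).
  { apply Rlt_le_trans with (2 := Hk3). apply Rmult_lt_0_compat; [|lra].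
    apply pow_lt; lra. }
  assert (Hkx : INR k * ((1 + delta) * x) <= L).
  { apply Rmult_le_compat_r with (r := (1 + delta) * x) in Hk1; [|nra].
    replace (L / ((1 + delta) * x) * ((1 + delta) * x)) with L in Hk1
      by (field; lra). exact Hk1. }
  assert (Hza : 0 < (1 - delta) ^ a) by (apply pow_lt; lra).
  exists t, a, k, (1 - delta), (exp (- (delta * INR m / INR t)) / (1 - delta) ^ a),
    (exp (- (1 * L / INR k))).
  repeat split; try (apply INR_lt; simpl; lra); try lra.
  - left. apply Rmult_lt_0_compat; [apply exp_pos|]. apply Rinv_0_lt_compat, Hza.
  - left. apply exp_pos.
  - replace (exp (- (delta * INR m / INR t)) / (1 - delta) ^ a * (1 - delta) ^ a)
      with (exp (- (delta * INR m / INR t))) by (field; lra).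
    replace (INR t - 1 + (1 - delta)) with (INR t - delta) by ring.
    apply sub_pow_le_exp; [lra|].
    assert (1 <= INR t) by (apply (le_INR 1), INR_lt; simpl; lra). lra.
  (* Here [q <= m ^ (-4)]. The factor [exp (- delta * x ^ 2)] beats [(1 - delta) ^ (- a) <= exp
     (delta * (1 - delta) * x ^ 2)] by [exp (- delta ^ 2 * x ^ 2)], which is at most
     [exp (- 4 * x)]. *)
  - assert (Hq : exp (- (delta * INR m / INR t)) / (1 - delta) ^ a
        <= exp (- (4 * x))).
    { assert (H1 : exp (- (delta / (1 - delta))) <= 1 - delta).
      { pose proof (exp_ineq1_le (delta / (1 - delta))) as H.
        replace (1 + delta / (1 - delta)) with (/ (1 - delta)) in H by (field; lra).
        rewrite exp_Ropp. rewrite <- (Rinv_inv (1 - delta)) at 2.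
        apply Rinv_le_contravar; [|exact H]. apply Rinv_0_lt_compat; lra. }
      assert (H2 : exp (INR a * (- (delta / (1 - delta)))) <= (1 - delta) ^ a).
      { rewrite <- exp_pow. apply pow_incr. split; [left; apply exp_pos|exact H1]. }
      apply Rmult_le_reg_r with ((1 - delta) ^ a); [exact Hza|].
      unfold Rdiv at 1. rewrite Rmult_assoc, Rinv_l, Rmult_1_r by lra.
      apply Rle_trans with (exp (- (4 * x)) * exp (INR a * (- (delta / (1 - delta)))));
        [|apply Rmult_le_compat_l; [left; apply exp_pos|exact H2]].
      rewrite <- exp_plus.
      assert (H3 : INR a * (delta / (1 - delta)) <= delta * (1 - delta) * x ^ 2).
      { apply Rle_trans with ((1 - delta) ^ 2 * x ^ 2 * (delta / (1 - delta))).
        - apply Rmult_le_compat_r; [|exact Ha1].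
          apply Rmult_le_pos; [lra|]. left. apply Rinv_0_lt_compat; lra.
        - right. field. lra. }
      assert (H4 : delta * x ^ 2 <= delta * INR m / INR t).
      { unfold Rdiv. rewrite Rmult_assoc. apply Rmult_le_compat_l; [lra|exact HtL']. }
      assert (H5 : 4 * x <= delta ^ 2 * x ^ 2).
      { replace (delta ^ 2 * x ^ 2) with (x * delta ^ 2 * x) by ring.
        apply Rmult_le_compat_r; lra. }
      assert (H6 : - (delta * INR m / INR t)
          <= - (4 * x) + INR a * - (delta / (1 - delta))) by lra.
      destruct H6 as [H6|H6]; [left; apply exp_increasing, H6|rewrite H6; lra]. }
    set (q := exp (- (delta * INR m / INR t)) / (1 - delta) ^ a) in *.
    assert (Hq' : exp (- (4 * x)) * INR m ^ 4 = 1).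
    { rewrite Hm, exp_pow, <- exp_plus, <- exp_0. f_equal. simpl. ring. }
    assert (Htm : INR t <= INR m).
    { apply Rle_trans with (2 := HtL). rewrite <- (Rmult_1_r (INR t)) at 1.
      apply Rmult_le_compat_l; [lra|]. apply pow_R1_Rle. lra. }
    assert (Hq0 : 0 < exp (- (4 * x))) by apply exp_pos.
    apply Rle_trans with (4 * (INR t * exp (- (4 * x))) * (INR m * INR m)).
    + apply Rmult_le_compat_r; [apply Rle_0_sqr|].
      apply Rmult_le_compat_l; [lra|]. apply Rmult_le_compat_l; lra.
    + rewrite <- Hq'.
      replace (4 * (INR t * exp (- (4 * x))) * (INR m * INR m))
        with (exp (- (4 * x)) * (INR m ^ 2 * (4 * INR t))) by ring.
      replace (INR m ^ 4) with (INR m ^ 2 * (INR m * INR m)) by ring.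
      apply Rmult_le_compat_l; [lra|].
      apply Rmult_le_compat_l; [apply pow2_ge_0|]. apply Rmult_le_compat; lra.
  - apply sub_pow_le_exp; [lra|]. apply (le_INR 1), INR_lt. simpl. lra.
  (* Here [r <= m ^ (- 1 - delta)]: one factor [m] pays for the degree, and [m ^ delta] for the
     remaining [4 * L ^ 2 <= 16 * x ^ 4]. *)
  - assert (Hr : exp (- (1 * L / INR k)) <= exp (- ((1 + delta) * x))).
    { assert (H : (1 + delta) * x <= L / INR k).
      { apply Rmult_le_reg_r with (INR k); [lra|].
        replace (L / INR k * INR k) with L by (field; lra). lra. }
      rewrite Rmult_1_l. destruct H as [H|H]; [left; apply exp_increasing; lra|].
      rewrite H. lra. }
    assert (Hr' : exp (- ((1 + delta) * x)) * (INR m * exp (delta * x)) = 1).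
    { rewrite Hm, <- !exp_plus. transitivity (exp 0); [f_equal; ring|apply exp_0]. }
    fold L. set (r := exp (- (1 * L / INR k))) in *.
    assert (Hr0 : 0 < exp (- ((1 + delta) * x))) by apply exp_pos.
    assert (HkL : INR k <= L).
    { apply Rle_trans with (2 := Hkx). rewrite <- (Rmult_1_r (INR k)) at 1.
      apply Rmult_le_compat_l; [lra|]. rewrite <- (Rmult_1_r 1).
      apply Rmult_le_compat; lra. }
    rewrite <- Hr'.
    apply Rle_trans with (4 * (L * exp (- ((1 + delta) * x))) * (L * INR m)).
    + apply Rmult_le_compat_r; [apply Rmult_le_pos; lra|].
      apply Rmult_le_compat_l; [lra|].
      apply Rmult_le_compat; try lra. left. apply exp_pos.
    + replace (4 * (L * exp (- ((1 + delta) * x))) * (L * INR m))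
        with (exp (- ((1 + delta) * x)) * (INR m * (4 * L ^ 2))) by ring.
      apply Rmult_le_compat_l; [lra|]. apply Rmult_le_compat_l; [lra|].
      apply Rle_trans with (2 := Hmd).
      assert (H : L ^ 2 <= (2 * x ^ 2) ^ 2) by (apply pow_incr; lra).
      replace ((2 * x ^ 2) ^ 2) with (4 * x ^ 4) in H by ring. lra.
  - rewrite mult_INR.
    apply Rle_trans with ((1 - delta) * (INR m / x ^ 2) * ((1 - delta) ^ 4 * x)).
    + replace ((1 - delta) * (INR m / x ^ 2) * ((1 - delta) ^ 4 * x))
        with ((1 - delta) ^ 5 * (INR m / x)) by (field; lra).
      replace ((1 - 5 * delta) * INR m / x) with ((1 - 5 * delta) * (INR m / x))
        by (field; lra).
      apply Rmult_le_compat_r.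
      * apply Rmult_le_pos; [lra|]. left. apply Rinv_0_lt_compat; lra.
      * replace 5 with (INR 5) at 1 by (simpl; ring). apply one_sub_pow_ge. lra.
    + apply Rmult_le_compat; try lra.
      * apply Rmult_le_pos; [lra|]. apply Rmult_le_pos; [lra|].
        left. apply Rinv_0_lt_compat; lra.
      * apply Rmult_le_pos; [apply pow_le; lra|lra].
Qed.

Local Close Scope R_scope.

(** * Linear maps to the integers *)

Local Open Scope Z_scope.

Lemma exists_abs_bound (l : list Z) : exists B, 0 < B /\ forall z, In z l -> Z.abs z < B.
Proof.
  induction l as [|y l [B [HB Hl]]].
  - exists 1. split; [lia|intros z []].
  - exists (B + Z.abs y). split; [lia|].
    intros z [<-|Hz]; [lia|]. specialize (Hl z Hz). lia.
Qed.

(** The coordinates are read as base-[B] digits, possibly negative, lowest first; this makes the map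
    linear. *)
Definition horner (B : Z) (x : list Z) : Z := fold_right (fun a r => a + B * r) 0 x.

Lemma horner_vadd (B : Z) (x y : list Z) :
  length x = length y -> horner B (vadd x y) = horner B x + horner B y.
Proof.
  revert y. induction x as [|a x IH]; intros [|b y] H; try discriminate H.
  - reflexivity.
  - change (a + b + B * horner B (vadd x y) = a + B * horner B x + (b + B * horner B y)).
    rewrite IH by (injection H; auto). ring.
Qed.

(** Lowest digits agree modulo [B] and differ by less than [B], so they are equal; the rest follows
    by induction. *)
Lemma horner_inj (B : Z) (x y : list Z) :
  0 < B -> length x = length y ->
  (forall z, In z x \/ In z y -> 2 * Z.abs z < B) ->
  horner B x = horner B y -> x = y.
Proof.
  intros HB. revert y. induction x as [|a x IH]; intros [|b y] H Hz E; try discriminate H.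
  - reflexivity.
  - change (a + B * horner B x = b + B * horner B y) in E.
    assert (Ha : 2 * Z.abs a < B) by (apply Hz; left; left; reflexivity).
    assert (Hb : 2 * Z.abs b < B) by (apply Hz; right; left; reflexivity).
    assert (E' : horner B x = horner B y) by nia.
    rewrite E' in E. rewrite (IH y); [f_equal; lia| | |exact E'].
    + injection H; auto.
    + intros z [Hx|Hy]; apply Hz; [left|right]; right; assumption.
Qed.

Local Close Scope Z_scope.

Module FiniteHypergraphs.

Import all_boot all_order all_algebra ring lra zify Rstruct.
Import Order.TTheory GRing.Theory Num.Theory.
Set Implicit Arguments.
Unset Strict Implicit.
Unset Printing Implicit Defensive.
Local Open Scope ring_scope.

(** * The local lemma *)

Section LocalLemma.

Variables (R : realFieldType) (Omega I : finType) (A : I -> {set Omega}).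

Definition avoiding (T : {set I}) : {set Omega} :=
  [set w | [forall i in T, w \notin A i]].

Lemma avoidingP (T : {set I}) w :
  reflect (forall i, i \in T -> w \notin A i) (w \in avoiding T).
Proof. by rewrite inE; apply: (iffP forall_inP). Qed.

Lemma avoidingS (T U : {set I}) : T \subset U -> avoiding U \subset avoiding T.
Proof.
move=> /subsetP sTU; apply/subsetP => w /avoidingP wU.
by apply/avoidingP => i /sTU; apply: wU.
Qed.

Variables (G : I -> {set I}) (D : nat) (p : R).
Hypotheses (Gi : forall i, i \in G i) (GD : forall i, (#|G i| <= D)%N).
Hypotheses (p0 : 0 <= p) (pD : 4 * p * D%:R <= 1).
Hypothesis indep : forall i (T : {set I}), [disjoint T & G i] ->
  #|A i :&: avoiding T|%:R <= p * #|avoiding T|%:R.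

(** Counting form of a bound [2 * p] on the probability of [A i] given that [T] is avoided. Dropping
    from [T] the neighbours of [i] makes [indep] applicable and, by induction, at most doubles the
    avoiding set. *)
Lemma local_lemma_conditional (T : {set I}) i :
  #|A i :&: avoiding T|%:R <= 2 * p * #|avoiding T|%:R.
Proof.
have [n] := ubnP #|T|; elim: n T i => // n IHn T i ltTn.
have g0 : (0 : R) <= #|avoiding T|%:R by [].
have [dT|ndT] := boolP [disjoint T & G i].
  by apply: le_trans (indep dT) _; have := mulr_ge0 p0 g0; lra.
set U := T :\: G i.
have ltUT : (#|U| < #|T|)%N.
  apply: proper_card; rewrite properE subsetDl /=.
  apply: contra ndT => /subsetP sTU; rewrite disjoint_subset.
  by apply/subsetP => j /sTU; rewrite !inE => /andP[].
have IHU j : #|A j :&: avoiding U|%:R <= 2 * p * #|avoiding U|%:R.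
  by apply: IHn; apply: leq_trans ltUT _.
have gU0 : (0 : R) <= #|avoiding U|%:R by [].
(* A union bound over the neighbours of [i]: by induction and [4 * p * D <= 1] they remove at most
   half of [avoiding U]. *)
have cov : avoiding U \subset
    avoiding T :|: \bigcup_(j in G i) (A j :&: avoiding U).
  apply/subsetP => w wU; rewrite inE.
  have [wT|/avoidingP wT] := boolP (w \in avoiding T) => //=.
  apply/bigcupP; case: (pickP [pred j | (j \in G i) && (w \in A j)]) => [j|noj].
    by case/andP=> jG wA; exists j; rewrite // inE wA.
  case: wT => j jT; have [jG|jG] := boolP (j \in G i).
    by have := noj j; rewrite /= jG /= => ->.
  by move/avoidingP: wU; apply; rewrite inE jG.
have cov' : #|avoiding U|%:R <=
    #|avoiding T|%:R + (\sum_(j in G i) #|A j :&: avoiding U|)%:R :> R.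
  rewrite -natrD ler_nat; apply: leq_trans (subset_leq_card cov) _.
  apply: leq_trans (leq_card_setU _ _) _; rewrite leq_add2l.
  elim/big_rec2: _ => [|j s1 s2 _ IH]; first by rewrite cards0.
  by apply: leq_trans (leq_card_setU _ _) _; rewrite leq_add2l.
have covS : (\sum_(j in G i) #|A j :&: avoiding U|)%:R <=
    D%:R * (2 * p * #|avoiding U|%:R) :> R.
  rewrite natr_sum; apply: le_trans (ler_sum _ (fun j _ => IHU j)) _.
  rewrite sumr_const -[leLHS]mulr_natl ler_wpM2r ?ler_nat //.
  by rewrite !mulr_ge0.
have le2 : #|avoiding U|%:R <= 2 * #|avoiding T|%:R :> R.
  by have := ler_wpM2r gU0 pD; lra.
have dU : [disjoint U & G i].
  by rewrite disjoint_subset; apply/subsetP => j; rewrite !inE => /andP[].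
have sU : #|A i :&: avoiding T|%:R <= #|A i :&: avoiding U|%:R :> R.
  by rewrite ler_nat subset_leq_card // setIS // avoidingS // subsetDl.
by have := indep dU; have := ler_wpM2l p0 le2; lra.
Qed.

(** Events are added one at a time; each removes at most a fraction [2 * p <= 1 / 2] of the outcomes
    left, because [G i] contains [i] and so [D >= 1]. *)
Lemma local_lemma : (0 < #|Omega|)%N -> exists w, forall i, w \notin A i.
Proof.
move=> Om0; have pos (T : {set I}) : (0 < #|avoiding T|)%N.
  have [n] := ubnP #|T|; elim: n T => // n IHn T ltTn.
  have [->|/set0Pn[i iT]] := eqVneq T set0.
    rewrite (_ : avoiding set0 = setT) ?cardsT //.
    by apply/setP => w; rewrite in_setT; apply/avoidingP => i; rewrite inE.
  have g0 : (0 < #|avoiding (T :\ i)|)%N.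
    by apply: IHn; rewrite (cardsD1 i) iT in ltTn.
  have p4 : 4 * p <= 1.
    apply: le_trans pD; rewrite ler_peMr ?mulr_ge0 // ler1n.
    by apply: leq_trans (GD i); rewrite card_gt0; apply/set0Pn; exists i.
  have cov : #|avoiding (T :\ i)|%:R <=
      #|avoiding T|%:R + #|A i :&: avoiding (T :\ i)|%:R :> R.
    rewrite -natrD ler_nat; apply: leq_trans (leq_card_setU _ _).
    apply/subset_leq_card/subsetP => w wT; rewrite !in_setU in_setI wT andbT.
    have [//|wA] := boolP (w \in A i); first by rewrite orbT.
    rewrite orbF; apply/avoidingP => j jT; have [->//|ji] := eqVneq j i.
    by move/avoidingP: wT; apply; rewrite !inE ji.
  have le2 := local_lemma_conditional (T :\ i) i.
  move: g0; rewrite -!(ltr0n R) => g0.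
  by have := ler_wpM2r (ltW g0) p4; lra.
have := pos setT; rewrite card_gt0 => /set0Pn[w /avoidingP wA].
by exists w => i; apply: wA.
Qed.

End LocalLemma.

(** * Independence and tail bounds for uniform random colourings *)

Section ProductSpace.

Variables (V C : finType).
Implicit Types (E : {set V}) (f g : {ffun V -> C}) (A B : {set {ffun V -> C}}).

Definition depends_on E A :=
  forall f g, {in E, f =1 g} -> f \in A -> g \in A.

Definition splice E f g : {ffun V -> C} := [ffun v => if v \in E then f v else g v].

(* The bijection (f, g) |-> (f on E and g off E, g on E and f off E) of pairs
   carries (A :&: B) x Omega onto A x B. *)
Lemma card_indep E A B : depends_on E A -> depends_on (~: E) B ->
  (#|A :&: B| * #|{ffun V -> C}| = #|A| * #|B|)%N.
Proof.
move=> dA dB.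
pose sw (fg : {ffun V -> C} * {ffun V -> C}) :=
  (splice E fg.1 fg.2, splice E fg.2 fg.1).
have swK : involutive sw.
  case=> f g; congr (_, _); apply/ffunP => v; rewrite !ffunE;
    by case: ifP => vE; rewrite /= ?ffunE ?vE.
rewrite -cardsT -!cardsX -(card_imset _ (inv_inj swK)); apply: eq_card => -[f g].
have -> : ((f, g) \in sw @: setX (A :&: B) setT) = (sw (f, g) \in setX (A :&: B) setT).
  apply/imsetP/idP => [[fg fgAB ->]|H]; first by rewrite swK.
  by exists (sw (f, g)) => //; rewrite swK.
rewrite !inE /= andbT; congr andb; apply/idP/idP.
- by apply: dA => v vE; rewrite ffunE vE.
- by apply: dA => v vE; rewrite ffunE vE.
- by apply: dB => v; rewrite inE => /negbTE vE; rewrite ffunE vE.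
- by apply: dB => v; rewrite inE => /negbTE vE; rewrite ffunE vE.
Qed.

(* Chernoff bound: Markov's inequality for z ^+ #{v in E : f v = c}. *)
Lemma card_few_colored (R : realFieldType) E (c : C) (a : nat) (z : R) :
  0 <= z <= 1 ->
  #|[set f : {ffun V -> C} | (#|[set v in E | f v == c]| <= a)%N]|%:R * z ^+ a
  <= (#|C|%:R - 1 + z) ^+ #|E| * #|C|%:R ^+ #|~: E|.
Proof.
case/andP=> z0 z1.
(* The sum over all [f] of [z] to the number of [c]-coloured vertices of [E] factors over vertices:
   [#|C| - 1 + z] on [E] and [#|C|] off it. *)
pose F v d : R := if (v \in E) && (d == c) then z else 1.
have -> : (#|C|%:R - 1 + z) ^+ #|E| * #|C|%:R ^+ #|~: E| = \prod_v \sum_d F v d.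
  rewrite (bigID (mem E)) /=; congr (_ * _).
    rewrite -prodr_const; apply: eq_bigr => v vE.
    rewrite (bigD1 c) //= /F vE eqxx /= addrC; congr (_ + _).
    rewrite (eq_bigr (fun=> 1)) => [|d /negbTE-> //].
    by rewrite sumr_const cardC1 -subn1 natrB //; apply/card_gt0P; exists c.
  rewrite -prodr_const (eq_bigl (fun v => v \notin E)) => [|v]; last by rewrite inE.
  apply: eq_bigr => v /negbTE vE; rewrite (eq_bigr (fun=> 1)) => [|d _].
    by rewrite sumr_const.
  by rewrite /F vE.
rewrite bigA_distr_bigA /=.
have FE f : \prod_v F v (f v) = z ^+ #|[set v in E | f v == c]|.
  by rewrite -prodr_const /= [RHS]big_mkcond; apply: eq_bigr => v _; rewrite inE.
rewrite (bigID (mem [set f : {ffun V -> C} | (#|[set v in E | f v == c]| <= a)%N])) /=.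
rewrite -[leLHS]addr0 lerD ?sumr_ge0 // => [|f _]; last by rewrite FE exprn_ge0.
rewrite mulr_natl -sumr_const ler_sum // => f; rewrite inE => fa.
by rewrite FE ler_wiXn2l.
Qed.

End ProductSpace.

(** * Polychromatic colourings of finite hypergraphs *)

Section Colorings.

Variables (R : realFieldType) (V I : finType).
Implicit Types (E : I -> {set V}).

Lemma card_meeting_edges E (m D : nat) i :
  #|E i| = m -> (forall v, #|[set j | v \in E j]| <= D)%N ->
  (#|[set j | ~~ [disjoint E i & E j]]| <= m * D)%N.
Proof.
move=> Em degE.
have sub : [set j | ~~ [disjoint E i & E j]] \subset
    \bigcup_(v in E i) [set j | v \in E j].
  apply/subsetP => j; rewrite inE => /pred0Pn[v /andP[vi vj]].
  by apply/bigcupP; exists v; rewrite ?inE.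
apply: leq_trans (subset_leq_card sub) _; rewrite -Em -sum_nat_const.
elim/big_rec2: _ => [|v s1 s2 _ IH]; first by rewrite cards0.
by apply: leq_trans (leq_card_setU _ _) _; rewrite leq_add.
Qed.

(** Local lemma with one bad event per edge, a union over the [t] colours. Requiring [0 < z ^+ a]
    rather than [0 < z] admits [z = 0], [a = 0]. *)
Lemma exists_coloring_many_of_each E (m D t a : nat) (z q : R) :
  (0 < m)%N -> (0 < t)%N -> (forall i, #|E i| = m) ->
  (forall v, #|[set j | v \in E j]| <= D)%N ->
  0 <= z <= 1 -> 0 < z ^+ a -> 0 <= q ->
  (t%:R - 1 + z) ^+ m <= q * z ^+ a * t%:R ^+ m ->
  4 * (t%:R * q) * (m * D)%:R <= 1 ->
  exists f : V -> 'I_t, forall i c, (a < #|[set v in E i | f v == c]|)%N.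
Proof.
move=> m0 t0 Em degE z01 za0 q0 tail small.
pose few i c := [set f : {ffun V -> 'I_t} | (#|[set v in E i | f v == c]| <= a)%N].
pose A i := \bigcup_c few i c.
pose G i := [set j | ~~ [disjoint E i & E j]].
have Om0 : (0 < #|{ffun V -> 'I_t}|)%N.
  by apply/card_gt0P; exists [ffun=> Ordinal t0].
have Om : #|{ffun V -> 'I_t}|%:R = t%:R ^+ #|V| :> R.
  by rewrite card_ffun card_ord natrX.
have few_le i c : #|few i c|%:R <= q * #|{ffun V -> 'I_t}|%:R :> R.
  rewrite -(ler_pM2r za0); apply: le_trans (card_few_colored _ _ _ z01) _.
  rewrite Em card_ord Om -(cardsC (E i)) Em exprD.
  rewrite [leRHS](_ : _ = q * z ^+ a * t%:R ^+ m * t%:R ^+ #|~: E i|); last by ring.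
  by apply: ler_wpM2r => //; apply: exprn_ge0.
have A_le i : #|A i|%:R <= t%:R * q * #|{ffun V -> 'I_t}|%:R :> R.
  have le1 : #|A i|%:R <= (\sum_c #|few i c|)%:R :> R.
    rewrite ler_nat /A; elim/big_rec2: _ => [|c s1 s2 _ IH]; first by rewrite cards0.
    by apply: leq_trans (leq_card_setU _ _) _; rewrite leq_add2l.
  apply: le_trans le1 _; rewrite natr_sum.
  apply: le_trans (ler_sum _ (fun c _ => few_le i c)) _.
  by rewrite sumr_const card_ord -[leLHS]mulr_natl mulrA.
have fewP i (f g : {ffun V -> 'I_t}) : {in E i, f =1 g} ->
    (f \in A i) = (g \in A i).
  move=> fg; have eqs c : [set v in E i | f v == c] = [set v in E i | g v == c].
    by apply/setP => v; rewrite !inE; case: (boolP (v \in E i)) => //= /fg ->.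
  by apply/bigcupP/bigcupP => -[c _ fc]; exists c => //; move: fc; rewrite !inE eqs.
have [|||||f Af] := @local_lemma R _ _ A G (m * D) (t%:R * q) _ _ _ _ _ Om0.
- move=> i; rewrite inE -setI_eq0 setIid; apply/negP => /eqP E0.
  by rewrite -(Em i) E0 cards0 in m0.
- by move=> i; apply: card_meeting_edges.
- by rewrite mulr_ge0.
- by [].
(* The edges in [T] are disjoint from [E i], so avoiding [T] depends only on vertices off [E i], and
   [card_indep] applies. *)
- move=> i T dT; have Om0' : 0 < #|{ffun V -> 'I_t}|%:R :> R by rewrite ltr0n.
  rewrite -(ler_pM2r Om0') -natrM (@card_indep _ _ (E i)).
  + by rewrite natrM mulrAC; apply: ler_wpM2r.
  + by move=> f g /fewP->.
  + move=> f g fg /avoidingP fT; apply/avoidingP => j jT; rewrite -(fewP j f) ?fT //.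
    move=> v vj; apply: fg; rewrite inE; apply/negP => vi.
    have /pred0P/(_ j) := dT; rewrite /= jT inE /= => /negbFE/pred0P/(_ v).
    by rewrite /= vi vj.
exists f => i c; rewrite ltnNge; apply: contra (Af i) => fc.
by apply/bigcupP; exists c; rewrite ?inE.
Qed.

(* Splitting V first shrinks the edges, and hence the number of edges that a
   given edge meets, from about m ^ 2 to about m; this is what turns the
   constant 1/3 of the plain local lemma into 1. *)
Lemma exists_polychromatic_two_step E (m t a k : nat) (z q r : R) :
  (0 < m)%N -> (0 < t)%N -> (0 < k)%N -> (forall i, #|E i| = m) ->
  (forall v, #|[set j | v \in E j]| <= m)%N ->
  0 <= z <= 1 -> 0 < z ^+ a -> 0 <= q -> 0 <= r ->
  (t%:R - 1 + z) ^+ m <= q * z ^+ a * t%:R ^+ m ->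
  4 * (t%:R * q) * (m * m)%:R <= 1 ->
  (k%:R - 1) ^+ a.+1 <= r * k%:R ^+ a.+1 ->
  4 * (k%:R * r) * (a.+1 * m)%:R <= 1 ->
  exists c : V -> 'I_t * 'I_k, forall i b, exists2 v, v \in E i & c v = b.
Proof.
move=> m0 t0 k0 Em degE z01 za0 q0 r0 tail1 small1 tail2 small2.
have [f fE] := exists_coloring_many_of_each m0 t0 Em degE z01 za0 q0 tail1 small1.
have part b : exists g : {ffun V -> 'I_k}, forall i c,
    exists2 v, v \in E i & f v = b /\ g v = c.
  (* Each edge is cut down to exactly [a.+1] vertices of class [b], since the colouring lemma needs
     uniform edges; degrees do not grow. *)
  have sub i : exists F : {set V}, F \subset [set v in E i | f v == b] /\ #|F| = a.+1.
    have /card_geqP[s [us ss sF]] := fE i b.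
    exists [set v in s]; split; last by rewrite cardsE (card_uniqP us).
    by apply/subsetP => v; rewrite inE => /sF.
  have [F FP] := fin_all_exists sub.
  have degF v : (#|[set j | v \in F j]| <= m)%N.
    apply: leq_trans (degE v); apply/subset_leq_card/subsetP => j; rewrite !inE.
    by have [/subsetP sF _] := FP j => /sF; rewrite inE => /andP[].
  (* With [z = 0] and [a = 0], where [0 ^+ 0 = 1], the tail is the chance of missing a colour and
     the conclusion is that every colour occurs. *)
  have [|||||g gF] := @exists_coloring_many_of_each F a.+1 m k 0 0 r (ltn0Sn _) k0 
    (fun i => (FP i).2) degF; rewrite ?expr0 ?lexx ?ler01 ?ltr01 ?addr0 ?mulr1 //.
  exists (finfun g) => i c; have := gF i c.
  case/card_gt0P=> v; rewrite inE => /andP[vF /eqP gv].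
  have [/subsetP/(_ v vF)] := FP i; rewrite inE => /andP[vE /eqP fv] _.
  by exists v; rewrite ?ffunE.
have [g gP] := fin_all_exists part.
exists (fun v => (f v, g (f v) v)) => i [b c].
by have [v vE [fv gv]] := gP b i c; exists v; rewrite // fv gv.
Qed.

End Colorings.

(** * Translates of a finite set of integers *)

Local Close Scope ring_scope.

Lemma In_mem (T : eqType) (s : seq T) x : In x s <-> x \in s.
Proof.
elim: s => //= y s IH; rewrite inE IH; split=> [[->|->]|/orP[/eqP->|]];
  by rewrite ?eqxx ?orbT; auto.
Qed.

Lemma NoDup_map_uniq (T : Type) (U : eqType) (f : T -> U) (s : list T) :
  NoDup s -> (forall x y, In x s -> In y s -> f x = f y -> x = y) ->
  uniq (map f s).
Proof.
elim: s => //= x s IH /NoDup_cons_iff[xs us] inj; rewrite IH //; last first.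
  by move=> y y' ys y's; apply: inj; right.
rewrite andbT; apply/negP => /In_mem/in_map_iff[y [fyx ys]].
by apply: xs; rewrite (inj x y) //; auto.
Qed.

(** The vertices are residues modulo [M] and the edges are the translates of [S]. A residue [v] lies
    only in the translates by [v - s], which bounds the degree by the edge size. *)
Lemma exists_polychromatic_translates (S : list Z) t a k z q r :
  NoDup S -> two_step_parameters (length S) t a k z q r ->
  exists c : Z -> nat, (forall x, lt (c x) (Nat.mul t k)) /\
    forall n j, lt j (Nat.mul t k) -> exists s, In s S /\ c (Z.add n s) = j.
Proof.
move=> uS [[m0 [t0 k0]] [[[z0 z1] [q0 r0]] [[tail1 small1] [tail2 small2]]]].
have [B [B0 SB]] := exists_abs_bound S.
(* The modulus [M = 2 * B + 1] exceeds every difference of two elements of [S], so their residues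
   stay distinct. *)
pose N := Z.to_nat (Z.mul 2 B); pose M := Z.of_nat N.+1.
have M0 : Z.lt 0 M by rewrite /M; lia.
pose cls x : 'I_N.+1 := inord (Z.to_nat (Z.modulo x M)).
have clsE x : Z.of_nat (cls x) = Z.modulo x M.
  have xM := Z.mod_pos_bound x M M0.
  by rewrite inordK; rewrite /M in xM *; lia.
have cls_eq x y : Z.modulo x M = Z.modulo y M -> cls x = cls y by rewrite /cls => ->.
have cls_nat (i : 'I_N.+1) : cls (Z.of_nat i) = i.
  apply: ord_inj; apply: Nat2Z.inj; rewrite clsE Z.mod_small // /M.
  by have := ltn_ord i; lia.
pose E (n : 'I_N.+1) : {set 'I_N.+1} :=
  [set v in map (fun s => cls (Z.add (Z.of_nat n) s)) S].
have Em n : #|E n| = length S.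
  rewrite cardsE (card_uniqP _) ?size_map //; apply: NoDup_map_uniq => // x y xS yS.
  move=> /(congr1 (fun i : 'I_N.+1 => Z.of_nat i)); rewrite !clsE => xy.
  have Mn0 : M <> Z0 by lia.
  have xM := Z.div_mod (Z.add (Z.of_nat n) x) M Mn0.
  have yM := Z.div_mod (Z.add (Z.of_nat n) y) M Mn0; rewrite xy in xM.
  have xyM : Z.lt (Z.abs (Z.sub x y)) M.
    by have := SB x xS; have := SB y yS; rewrite /M /N; lia.
  move: xM yM xyM; set u := Z.div _ _; set v := Z.div _ _.
  by move=> xM yM xyM; have uv : u = v; [nia|rewrite uv in xM; lia].
have degE v : #|[set n | v \in E n]| <= length S.
  have sub : [set n | v \in E n] \subset
      [set n in map (fun s => cls (Z.sub (Z.of_nat v) s)) S].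
    apply/subsetP => n; rewrite !inE => /In_mem/in_map_iff[s [<- sS]].
    apply/In_mem/in_map_iff; exists s; split=> //; rewrite -[RHS]cls_nat.
    by apply: cls_eq; rewrite clsE Zminus_mod_idemp_l; congr Z.modulo; lia.
  apply: leq_trans (subset_leq_card sub) _.
  by rewrite cardsE (leq_trans (card_size _)) // size_map.
have [c cP] : exists c : 'I_N.+1 -> 'I_t * 'I_k,
    forall i b, exists2 v, v \in E i & c v = b.
  apply: (@exists_polychromatic_two_step Rdefinitions.R _ _ E (length S) t a k z q r) => //.
  - exact/ssrnat.ltP.
  - exact/ssrnat.ltP.
  - exact/ssrnat.ltP.
  - by apply/andP; split; apply/RleP => //; apply: Rlt_le.
  - by rewrite exprn_gt0 //; apply/RltP.
  - exact/RleP.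
  - exact/RleP.
  - by rewrite -!INRE -!RpowE; apply/RleP.
  - by apply/RleP; rewrite natrM -!INRE (INR_IZR_INZ 4).
  - by rewrite -!INRE -!RpowE; apply/RleP.
  - by apply/RleP; rewrite natrM -!INRE (INR_IZR_INZ 4).
(* Pairs are numbered by mixed radix, to be decoded by quotient and remainder modulo [k]. *)
pose code (b : 'I_t * 'I_k) := b.1 * k + b.2.
exists (fun x => code (c (cls x))); split=> [x|n j /ssrnat.ltP jtk].
  case: (c _) => b1 b2; rewrite /code /=; have := ltn_ord b1; have := ltn_ord b2.
  by move=> *; nia.
have k0' : 0 < k by apply/ssrnat.ltP.
have jt : j %/ k < t by rewrite ltn_divLR.
have jk : j %% k < k by rewrite ltn_mod.
have [v] := cP (cls n) (Ordinal jt, Ordinal jk).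
rewrite inE => /In_mem/in_map_iff[s [<- sS]] cv; exists s; split=> //.
rewrite (_ : cls (Z.add n s) = cls (Z.add (Z.of_nat (cls n)) s)).
  by rewrite cv /code /= -divn_eq.
by apply: cls_eq; rewrite clsE Zplus_mod_idemp_l.
Qed.

End FiniteHypergraphs.

(** * Transfer from the integers to Z^d and the asymptotic bound *)

(** A colouring of the integers is pulled back along [horner (2 * B)]: additivity sends translates
    to translates, and injectivity is needed only on [S], whose coordinates are below [B] in
    absolute value. *)
Lemma p_Zd_ge_two_step (d : nat) (S : list (list Z)) (t a k : nat) (z q r : R) :
  finset_Zd d S -> two_step_parameters (length S) t a k z q r ->
  p_Zd_ge d S (INR (t * k)).
Proof.
  intros [uS dS] Hp. rewrite Forall_forall in dS.
  destruct (exists_abs_bound (concat S)) as [B [HB SB]].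
  assert (uS' : NoDup (map (horner (2 * B)) S)).
  { apply NoDup_map_NoDup_ForallPairs; [|exact uS].
    intros x y Hx Hy E. apply (horner_inj (2 * B)); try lia; try exact E.
    - rewrite (dS x Hx), (dS y Hy). reflexivity.
    - intros w [Hw|Hw]; assert (Z.abs w < B)%Z; try lia; apply SB, in_concat; eauto. }
  rewrite <- (length_map (horner (2 * B)) S) in Hp.
  destruct (FiniteHypergraphs.exists_polychromatic_translates uS' Hp)
    as [c [Hc1 Hc2]].
  exists (t * k). split; [apply Rge_refl|].
  exists (fun x => c (horner (2 * B) x)). split; [intros x _; apply Hc1|].
  intros n Hn j Hj.
  destruct (Hc2 (horner (2 * B) n) j Hj) as [s' [Hs' Hs]].
  apply in_map_iff in Hs'. destruct Hs' as [s [<- HsS]].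
  exists s. split; [exact HsS|]. rewrite horner_vadd; [exact Hs|].
  rewrite (dS s HsS). exact Hn.
Qed.

Theorem theorem19 (d : nat) (hd : (2 <= d)%nat) :
  forall eps : R, (0 < eps)%R ->
  exists N : nat, forall S : list (list Z),
    finset_Zd d S -> (N <= length S)%nat ->
    p_Zd_ge d S ((1 - eps) * INR (length S) / ln (INR (length S)))%R.
Proof.
  intros eps Heps.
  (* Chosen so that [5 * delta <= eps], while the minimum with 1 ensures [delta <= 1 / 5]. *)
  set (delta := (Rmin eps 1 / 5)%R).
  assert (Hd : (0 < delta <= 1 / 5)%R).
  { unfold delta. pose proof (Rmin_r eps 1). pose proof (Rmin_glb_lt eps 1 0). lra. }
  assert (Hde : (5 * delta <= eps)%R) by (unfold delta; pose proof (Rmin_l eps 1); lra).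
  set (X := (50000 / delta ^ 5)%R).
  assert (HX : (0 < X)%R).
  { apply Rdiv_lt_0_compat; [lra|]. apply pow_lt. lra. }
  destruct (INR_unbounded (exp X)) as [N HN].
  exists N. intros S HS HNS. apply le_INR in HNS.
  assert (Hln : (X <= ln (INR (length S)))%R).
  { rewrite <- (ln_exp X). left. apply ln_increasing; [apply exp_pos|lra]. }
  destruct (exists_two_step_parameters delta (length S) Hd Hln)
    as [t [a [k [z [q [r [Hp Hk]]]]]]].
  destruct (p_Zd_ge_two_step d S t a k z q r HS Hp) as [k' [Hk' Hc]].
  exists k'. split; [|exact Hc].
  apply Rle_ge. apply Rge_le in Hk'. apply Rle_trans with (2 := Hk').
  apply Rle_trans with (2 := Hk). unfold Rdiv.
  apply Rmult_le_compat_r; [left; apply Rinv_0_lt_compat; lra|].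
  apply Rmult_le_compat_r; [apply pos_INR|lra].
Qed.
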